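(* Let $M=\mathbb{R}/\mathbb{Z}$, let $f_0:M\to M$ be a saddle-node circle homeomorphism, let $(f_t)_{t\in[0,1]}$ be a continuous one-parameter family of circle homeomorphisms (with $f_t$ at $t=0$ equal to $f_0$), and let $(\theta_\varepsilon)_{\varepsilon>0}$ be probability measures on the parameter space $[0,1]$ with $\theta_\varepsilon\to\delta_0$ in the weak$^*$ topology as $\varepsilon\to0$. If for every $\varepsilon$ close to $0$ one chooses an $\varepsilon$-stationary probability measure $\mu^\varepsilon$, then every weak$^*$ accumulation point $\mu$ of $(\mu^\varepsilon)$ as $\varepsilon\to0$ equals the Dirac mass $\delta_0$.
   Context: A homeomorphism $f_0:M\to M$ is a saddle-node circle homeomorphism if $f_0(0)=0$, $f_0(x)\neq x$ for all $x\neq0$, and $f_0(x)>x$ for all $x\in V\setminus\{0\}$ for some open neighborhood $V$ of $0$. A probability measure $\mu$ on $M$ is $\varepsilon$-stationary if $\int\varphi\,d\mu=\iint\varphi(f_t(x))\,d\mu(x)\,d\theta_\varepsilon(t)$ for every continuous $\varphi:M\to\mathbb{R}$. *)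

(* Defs.v *)
From HB Require Import structures.
From mathcomp Require Import all_boot all_order all_algebra.
From mathcomp Require Import all_classical all_reals all_analysis.
Set Implicit Arguments. Unset Strict Implicit. Unset Printing Implicit Defensive.
Import Order.TTheory GRing.Theory Num.Theory.
Import numFieldNormedType.Exports.
Local Open Scope classical_set_scope.
Local Open Scope ring_scope.

(* The circle M = R/Z.  A point of M is represented by any real lift;
   two reals represent the same point of M iff they differ by an integer. *)
Definition eqM {R : realType} (x y : R) : Prop := exists k : int, y = x + k%:~R.

Definition nearM {R : realType} (e x y : R) : Prop :=
  exists k : int, `|y - x - k%:~R| < e.

Definition M_map {R : realType} (F : R -> R) : Prop :=
  forall x y, eqM x y -> eqM (F x) (F y).

Definition M_cont {R : realType} (F : R -> R) : Prop :=
  forall x e, 0 < e -> exists2 d, 0 < d &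
    forall y, nearM d x y -> nearM e (F x) (F y).

Definition circle_homeo {R : realType} (F : R -> R) : Prop :=
  [/\ M_map F, M_cont F &
    exists G : R -> R, [/\ M_map G, M_cont G,
      (forall x, eqM (G (F x)) x) & (forall x, eqM (F (G x)) x)]].

(* Saddle-node circle homeomorphism: f(0)=0, f(x)<>x for x<>0 in M, and
   f(x) > x (f moves x in the positive direction along a short arc) for every
   x <> 0 in the open arc V = (-d, d) around 0. *)
Definition saddle_node {R : realType} (F : R -> R) : Prop :=
  [/\ circle_homeo F, eqM (F 0) 0,
    (forall x, ~ eqM x 0 -> ~ eqM (F x) x) &
    exists2 d, 0 < d <= 2^-1 &
      forall x, 0 < `|x| < d ->
        exists2 s, 0 < s < 2^-1 & eqM (x + s) (F x)].

(* continuous functions M -> R = continuous 1-periodic functions R -> R *)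
Definition M_test {R : realType} (phi : R -> R) : Prop :=
  continuous phi /\ forall x, phi (x + 1) = phi x.

(* Probability measures on M are represented by Borel probability measures on
   R carried by the fundamental domain [0,1). *)
Definition M_prob {R : realType} (mu : probability R R) : Prop :=
  mu `[0%R, 1%R[%classic = 1%E.

Definition stationary {R : realType} (F : R -> R -> R)
    (theta mu : probability R R) : Prop :=
  forall phi : R -> R, M_test phi ->
    (\int[mu]_x (phi x)%:E =
     \int[theta]_(t in `[0%R, 1%R]%classic) \int[mu]_x (phi (F t x))%:E)%E.

(* Main.v *)
(** The limit measure is invariant under f_0: for a test function phi,
    phi o f_t is uniformly close to phi o f_0 when t is small, and theta_eps
    concentrates at t = 0, so the integrals of phi and of phi o f_0 against
    mu_eps differ by o(1).

    An f_0-invariant measure is the Dirac mass at 0: in the coordinate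
    x in [0, 1), the displacement f_0(x) - x is positive on (0, 1) and vanishes
    at 0.  The coordinate is a bounded pointwise limit of continuous functions
    on the circle, so by invariance and dominated convergence the displacement
    integrates to 0; hence (0, 1) is a null set. *)

Require Import Defs.
From HB Require Import structures.
From mathcomp Require Import all_boot all_order all_algebra.
From mathcomp Require Import all_classical all_reals all_analysis.
From mathcomp Require Import measurable_realfun ring lra.
Import Order.TTheory GRing.Theory Num.Theory.
Import numFieldNormedType.Exports.
Local Open Scope classical_set_scope.
Local Open Scope ring_scope.

(** * The representative in [0, 1) of a point of the circle *)

Section fractional_part.
Context {R : realType}.
Implicit Types (x y r : R) (k : int).

Definition fpart x : R := x - (Num.floor x)%:~R.

Lemma fpart_itv x : 0 <= fpart x < 1.
Proof.
have := floor_itv x; rewrite intrD => /andP[h1 h2]; rewrite /fpart.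
by apply/andP; split; lra.
Qed.

Lemma fpart_ge0 x : 0 <= fpart x. Proof. by case/andP: (fpart_itv x). Qed.

Lemma fpart_lt1 x : fpart x < 1. Proof. by case/andP: (fpart_itv x). Qed.

Lemma fpartDz r k : 0 <= r < 1 -> fpart (r + k%:~R) = r.
Proof.
move=> /andP[r0 r1]; rewrite /fpart (@floor_def _ _ k) ?addrK//.
by rewrite intrD; apply/andP; split; lra.
Qed.

Lemma fpart_id r : 0 <= r < 1 -> fpart r = r.
Proof. by move=> /(fpartDz r 0); rewrite addr0. Qed.

Lemma eqM_fpart x : eqM (fpart x) x.
Proof. by exists (Num.floor x); rewrite subrK. Qed.

Lemma fpart_eqM x y : eqM x y -> fpart x = fpart y.
Proof.
move=> [k ->]; rewrite -{2}(subrK (Num.floor x)%:~R x) -addrA -intrD.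
by rewrite fpartDz// fpart_itv.
Qed.

Lemma eqM_sym x y : eqM x y -> eqM y x.
Proof. by move=> [k ->]; exists (- k); rewrite intrN addrK. Qed.

Lemma eqM_trans y x z : eqM x y -> eqM y z -> eqM x z.
Proof. by move=> [k ->] [l ->]; exists (k + l); rewrite intrD addrA. Qed.

Lemma eqM_of_fpart x y : fpart x = fpart y -> eqM x y.
Proof.
move=> xy; apply: eqM_trans (eqM_fpart y).
by rewrite -xy; apply/eqM_sym/eqM_fpart.
Qed.

Lemma nearM_norm (e x y : R) : `|y - x| < e -> nearM e x y.
Proof. by exists 0; rewrite subr0. Qed.

(** [fpart] jumps only at the integers. The radius below also keeps the perturbed representative
    inside [0, 1), so no wrap-around occurs. *)
Lemma fpart_near x (e : R) : 0 < fpart x -> 0 < e ->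
  exists2 d, 0 < d & forall y, nearM d x y -> `|fpart x - fpart y| < e.
Proof.
move=> x0 e0; have x1 := fpart_lt1 x.
exists (Num.min e (Num.min (fpart x) (1 - fpart x))).
  by rewrite !lt_min e0 x0 subr_gt0.
move=> y [k]; rewrite !lt_min => /and3P[he].
rewrite ltr_norml => /andP[h1 _]; rewrite ltr_norml => /andP[_ h2].
have -> : fpart y = fpart x + (y - x - k%:~R); last by rewrite opprD addNKr normrN.
rewrite -[RHS](fpartDz _ (Num.floor x + k)).
  by congr fpart; rewrite intrD /fpart; ring.
by apply/andP; split; lra.
Qed.

End fractional_part.

(** * Continuous functions on the circle *)

Section test_functions.
Context {R : realType}.
Implicit Types (phi : R -> R).

Lemma M_test_eqM phi x y : M_test phi -> eqM x y -> phi x = phi y.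
Proof.
move=> [_ per].
have perN n z : phi (z + n%:R) = phi z.
  by elim: n z => [|n IH] z; rewrite ?addr0// -natr1 addrA per IH.
move=> [[n|n] ->]; first by rewrite -pmulrn perN.
by rewrite NegzE intrN -pmulrn -[in LHS](subrK n.+1%:R x) perN.
Qed.

Lemma M_test_near phi x (e : R) : M_test phi -> 0 < e ->
  exists2 d, 0 < d & forall y, nearM d x y -> `|phi x - phi y| < e.
Proof.
move=> phiT e0; have /cvgrPdist_lt/(_ e e0) := phiT.1 x.
move=> /nbhs_ballP[d d0 hd]; exists d => // y [k hk].
rewrite (M_test_eqM phi y (y - k%:~R) phiT); last first.
  by exists (- k); rewrite intrN.
by apply: hd; rewrite /ball/= distrC addrAC.
Qed.

Lemma M_test_comp phi (G : R -> R) :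
  M_map G -> M_cont G -> M_test phi -> M_test (phi \o G).
Proof.
move=> Gm Gc phiT; split; last first.
  move=> x /=; apply: M_test_eqM => //; apply: Gm.
  by apply: eqM_sym; exists 1.
move=> x; apply/cvgrPdist_lt => e e0.
have [d d0 hd] := M_test_near phi (G x) e phiT e0.
have [d' d'0 hd'] := Gc x d d0.
apply/nbhs_ballP; exists d' => // y; rewrite /ball/= distrC => xy.
exact/hd/hd'/nearM_norm.
Qed.

(** Periodicity reduces the bound to the compact interval [0, 1]. *)
Lemma M_test_bounded phi : M_test phi ->
  exists2 C, 0 <= C & forall x, `|phi x| <= C.
Proof.
move=> phiT.
have cpt : compact (phi @` `[0, 1]).
  apply: continuous_compact; last exact: segment_compact.
  exact/continuous_subspaceT/phiT.1.
have [M [Mr hM]] := compact_bounded cpt.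
exists (`|M| + 1); first by rewrite addr_ge0.
move=> x; rewrite -(M_test_eqM phi (fpart x) x phiT (eqM_fpart x)).
apply: (hM (`|M| + 1)); first by rewrite (le_lt_trans (ler_norm M))// ltrDl.
by exists (fpart x) => //=; rewrite in_itv/= fpart_ge0 ltW// fpart_lt1.
Qed.

Lemma M_test_measurable phi : M_test phi -> measurable_fun [set: R] phi.
Proof. by move=> [c _]; exact: continuous_measurable_fun. Qed.

Lemma bounded_integrable (P : probability R R) (D : set R) phi (C : R) :
  measurable D -> measurable_fun D phi ->
  (forall x, D x -> `|phi x| <= C) -> P.-integrable D (EFin \o phi).
Proof.
move=> mD mphi hC; apply: measurable_bounded_integrable => //.
  by rewrite (le_lt_trans (probability_le1 P mD))// ltry.
exists C; split; first exact: num_real.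
by move=> y Cy x Dx; exact: le_trans (hC _ Dx) (ltW Cy).
Qed.

Lemma M_test_integrable (P : probability R R) phi :
  M_test phi -> P.-integrable [set: R] (EFin \o phi).
Proof.
move=> phiT; have [C _ hC] := M_test_bounded phi phiT.
by apply: (bounded_integrable _ _ _ C) => //; exact: M_test_measurable.
Qed.

(** Gluing the ends of [0, 1]: the condition [h 0 = h 1] cancels the jump of [fpart] at the
    integers. *)
Lemma M_test_fpart (h : R -> R) : continuous h -> h 0 = h 1 ->
  M_test (h \o fpart).
Proof.
move=> hc h01; split; last first.
  by move=> x /=; congr h; apply/esym/fpart_eqM; exists 1.
move=> x; apply/cvgrPdist_lt => e e0 /=.
have [x0|x0] := ltP 0 (fpart x).
  have /cvgrPdist_lt/(_ e e0)/nbhs_ballP[d d0 hd] := hc (fpart x).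
  have [d' d'0 hd'] := fpart_near x d x0 d0.
  apply/nbhs_ballP; exists d' => // y; rewrite /ball/= distrC => xy.
  exact/hd/hd'/nearM_norm.
have {}x0 : fpart x = 0 by apply/eqP; rewrite eq_le x0 fpart_ge0.
have xE : x = (Num.floor x)%:~R by apply/eqP; rewrite -subr_eq0 -/(fpart x) x0.
(* At an integer, [fpart y] is close to 0 on the right and close to 1 on the left, so continuity of
   [h] is used at both ends. *)
have /cvgrPdist_lt/(_ e e0)/nbhs_ballP[d d0 hd] := hc 0.
have /cvgrPdist_lt/(_ e e0)/nbhs_ballP[d' d'0 hd'] := hc 1.
apply/nbhs_ballP; exists (Num.min 1 (Num.min d d')).
  by rewrite /= !lt_min ltr01 d0.
move=> y; rewrite /ball/= !lt_min => /and3P[].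
rewrite ltr_norml => /andP[y1 y2] yd yd'; rewrite x0.
have [xy|yx] := leP x y.
  have -> : fpart y = y - x.
    rewrite -[in LHS](subrK x y) {2}xE fpartDz//.
    by apply/andP; split; lra.
  by apply: hd; rewrite /ball/= sub0r opprB.
have -> : fpart y = y - x + 1.
  rewrite -(fpartDz (y - x + 1) (Num.floor x - 1)).
    by congr fpart; rewrite intrB {1}xE; ring.
  by apply/andP; split; lra.
by rewrite h01; apply: hd'; rewrite /ball/= opprD addrCA subrr addr0 opprB.
Qed.

End test_functions.

(** * The displacement of a saddle-node homeomorphism *)

Lemma circle_homeo_inj {R : realType} (f : R -> R) (x y : R) :
  circle_homeo f -> eqM (f x) (f y) -> eqM x y.
Proof.
move=> [_ _ [G [Gm _ GF _]]] /Gm h.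
exact: eqM_trans (eqM_sym _ _ (GF x)) (eqM_trans _ _ _ h (GF y)).
Qed.

(* On (0, 1) the displacement [fpart (f x) - x] is continuous and has no zero, so
   it keeps the positive sign it has just to the right of 0. *)
Lemma saddle_node_fpart_gt {R : realType} (f : R -> R) (x : R) :
  saddle_node f -> 0 < x < 1 -> x < fpart (f x).
Proof.
move=> [fh f0 fne [d /andP[d0 d2] hd]] /andP[x0 x1].
have ne0 (y : R) : 0 < y < 1 -> ~ eqM y 0.
  move=> /andP[y0 y1] /fpart_eqM.
  rewrite !fpart_id ?lexx ?ltr01 ?(ltW y0) ?y1// => y00.
  by rewrite y00 ltxx in y0.
(* By injectivity only the class of 0 is sent to 0; hence [f y] avoids the jump of [fpart]. *)
have fpos (y : R) : 0 < y < 1 -> 0 < fpart (f y).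
  move=> y01; rewrite lt_neqAle fpart_ge0 andbT; apply/eqP => fy0.
  apply: (ne0 y y01); apply: (circle_homeo_inj f) => //.
  apply: eqM_trans (eqM_sym _ _ f0); apply: eqM_of_fpart.
  by rewrite -fy0 fpart_id// lexx ltr01.
have fneq (y : R) : 0 < y < 1 -> fpart (f y) != y.
  move=> y01; apply/eqP => fy; apply: (fne y (ne0 y y01)).
  by apply: eqM_of_fpart; rewrite fy fpart_id//; case/andP: y01 => /ltW -> ->.
rewrite ltNge; apply/negP => fx.
pose a := Num.min x d / 2.
have m0 : 0 < Num.min x d by rewrite lt_min x0.
have mx : Num.min x d <= x by rewrite ge_min lexx.
have md : Num.min x d <= d by rewrite ge_min lexx orbT.
have a0 : 0 < a by rewrite /a; lra.
have ax : a < x by rewrite /a; lra.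
have ad : a < d by rewrite /a; lra.
(* Since [a < d <= 1/2] and [s < 1/2], the point [a + s] stays below 1 and is its own
   representative. *)
have fa : a < fpart (f a).
  have [|s /andP[s0 s1] /fpart_eqM <-] := hd a; first by rewrite gtr0_norm ?a0.
  by rewrite fpart_id ?ltrDl//; apply/andP; split; lra.
have gc : {within `[a, x], continuous (fun y => fpart (f y) - y)}.
  apply: continuous_in_subspaceT => y.
  rewrite inE/= in_itv/= => /andP[ay yx].
  apply: cvgB; last exact: cvg_id.
  apply/cvgrPdist_lt => e e0.
  have [|e' e'0 he'] := fpart_near (f y) e _ e0; first by apply: fpos; lra.
  have [_ fc _] := fh; have [d' d'0 hd'] := fc y e' e'0.
  apply/nbhs_ballP; exists d' => // z; rewrite /ball/= distrC => yz.
  exact/he'/hd'/nearM_norm.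
(* The displacement is positive at [a] and assumed nonpositive at [x]; a zero in between would be a
   forbidden fixed point. *)
have [|c] := @IVT _ _ _ _ 0 (ltW ax) gc.
  by rewrite ge_min le_max !subr_ge0 !subr_le0 fx (ltW fa) orbT.
rewrite in_itv/= => /andP[ac cx] /eqP; rewrite subr_eq0; apply/negP.
by apply: fneq; lra.
Qed.

(** * Invariant measures of a saddle-node homeomorphism *)

Section invariant_measure.
Context {R : realType} (f : R -> R) (mu : probability R R).
Hypothesis fsn : saddle_node f.
Hypothesis fmu : forall phi : R -> R, M_test phi ->
  \int[mu]_x phi (f x) = \int[mu]_x phi x.

Let displ x := fpart (f x) - fpart x.

Let fcomp phi : M_test phi -> M_test (phi \o f).
Proof. by have [[fm fc _] _ _ _] := fsn; exact: M_test_comp. Qed.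

Let displ_gt0 x : 0 < fpart x -> 0 < displ x.
Proof.
move=> x0; rewrite /displ subr_gt0.
have [[fm _ _] _ _ _] := fsn.
rewrite -(fpart_eqM _ _ (fm _ _ (eqM_fpart x))).
by apply: saddle_node_fpart_gt; rewrite // x0 fpart_lt1.
Qed.

Let displ_ge0 x : 0 <= displ x.
Proof.
have := fpart_ge0 x; rewrite le_eqVlt => /predU1P[x0|/displ_gt0/ltW//].
by rewrite /displ -x0 subr0 fpart_ge0.
Qed.

(* Test functions converging boundedly to the discontinuous [fpart]. *)
Let hat n (x : R) := fpart x - fpart x ^+ n.+1.

Let hat_test n : M_test (hat n).
Proof.
(* The exponent must be at least 1: with exponent 0 the values at 0 and 1 would differ. *)
apply: (M_test_fpart (fun y => y - y ^+ n.+1)); last first.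
  by rewrite expr0n expr1n !subrr.
by move=> y; apply: cvgB; [exact: cvg_id|exact: exprn_continuous].
Qed.

Let hat_itv n x : 0 <= hat n x <= 1.
Proof.
have [x0 /ltW x1] := andP (fpart_itv x).
rewrite /hat subr_ge0 exprS ler_piMr ?exprn_ile1//=.
by rewrite (le_trans _ x1)// gerBl mulr_ge0 ?exprn_ge0.
Qed.

Let hat_cvg x : hat n x @[n --> \oo] --> fpart x.
Proof.
rewrite -[X in _ --> X]subr0; apply: cvgB; first exact: cvg_cst.
have h : (GRing.exp (fpart x)) @ \oo --> (0 : R).
  by apply: cvg_expr; rewrite ger0_norm ?fpart_ge0 ?fpart_lt1.
by move: h; rewrite -cvg_shiftS.
Qed.

Let dhat n x := hat n (f x) - hat n x.

Let dhat_cvg x : dhat n x @[n --> \oo] --> displ x.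
Proof. exact: cvgB. Qed.

Let dhat_measurable n : measurable_fun [set: R] (dhat n).
Proof.
apply: measurable_funB; apply: M_test_measurable => //.
exact/fcomp/hat_test.
Qed.

Let displ_measurable : measurable_fun [set: R] displ.
Proof. by apply: measurable_fun_cvg dhat_measurable _ => x _; exact: dhat_cvg. Qed.

(** Each [dhat n] integrates to 0 by invariance. As a difference of two values in [0, 1] it is
    dominated by 1, so the limit integrates to 0 too. *)
Let displ_integral0 : (\int[mu]_x (displ x)%:E = 0)%E.
Proof.
have [|||||_ _] := @dominated_convergence _ _ _ mu setT measurableT
    (fun n => EFin \o dhat n) (EFin \o displ) (EFin \o cst 1).
- by move=> n; exact/measurable_EFinP.
- exact/measurable_EFinP.
- by apply: aeW => x _; apply: cvg_EFin; [exact: nearW|exact: dhat_cvg].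
- by apply: (bounded_integrable _ _ _ 1) => // x _ /=; rewrite normr1.
- apply: aeW => x n _ /=; rewrite lee_fin ler_norml.
  have /andP[] := hat_itv n x; have /andP[] := hat_itv n (f x).
  by rewrite /dhat => *; apply/andP; split; lra.
have h0 n : (\int[mu]_x ((EFin \o dhat n) x) = 0)%E.
  rewrite (integralB_EFin measurableT); last 2 first.
  - exact/M_test_integrable/fcomp/hat_test.
  - exact/M_test_integrable/hat_test.
  have := fmu _ (hat_test n); rewrite /Rintegral => h.
  rewrite -[X in (X - _)%E]fineK; last first.
    apply: integrable_fin_num => //.
    exact/M_test_integrable/fcomp/hat_test.
  rewrite -[X in (_ - X)%E]fineK; last first.
    by apply: integrable_fin_num => //; exact/M_test_integrable/hat_test.
  by rewrite h -EFinB subrr.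
rewrite [X in X @ _ --> _](_ : _ = cst 0%E); last first.
  by apply/funext => n; exact: h0.
by move=> h; apply/esym; apply: cvg_unique h => //; exact: cvg_cst.
Qed.

(** A nonnegative function with zero integral vanishes almost everywhere, while [displ] is positive
    on all of (0, 1). *)
Lemma invariant_saddle_node_itv : mu `]0%R, 1%R[%classic = 0%E.
Proof.
have : (\int[mu]_x `|(EFin \o displ) x| = 0)%E.
  rewrite -[RHS]displ_integral0; apply: eq_integral => x _ /=.
  by rewrite ger0_norm.
move/ae_eq_integral_abs => /(_ measurableT).
move=> []; first exact/measurable_EFinP.
move=> N [mN N0 hN]; apply: (subset_measure0 _ mN) => // x /=.
rewrite in_itv/= => /andP[x0 x1]; apply: hN => /= /(_ I) [].
apply/eqP; rewrite gt_eqF// displ_gt0// fpart_id//.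
by rewrite ltW.
Qed.

Lemma invariant_saddle_node_dirac : M_prob mu ->
  forall A, measurable A -> mu A = \d_(0 : R) A.
Proof.
move=> mu1 A mA.
have mu0 : mu [set 0] = 1%E.
  rewrite -mu1 -(@setU1itv _ R (BLeft 1) 0 false) ?bnd_simp ?ltr01//.
  rewrite measureU//; last first.
    by apply/seteqP; split => // x [/= ->]; rewrite in_itv/= ltxx.
  by rewrite [X in (_ + X)%E]invariant_saddle_node_itv adde0.
rewrite [RHS]diracE; case: (boolP (0 \in A)) => A0.
  apply/eqP; rewrite eq_le probability_le1//= -mu0 le_measure ?inE//.
  by move=> x /= ->; rewrite -inE.
have muC : mu (~` [set 0]) = 0%E by rewrite probability_setC// mu0 subee.
apply: (subset_measure0 mA _ _ muC); first exact: measurableC.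
by move=> x Ax /= x0; move: A0; rewrite notin_setE -x0.
Qed.

End invariant_measure.

(** * Averages over the family and the defect of invariance *)

Lemma Rintegral_probability_cst {R : realType} (P : probability R R) (r : R) :
  \int[P]_x cst r x = r.
Proof. by rewrite Rintegral_cst// [X in fine X]probability_setT mulr1. Qed.

Section family.
Context {R : realType} (F : R -> R -> R).
Hypothesis F_map : forall t, 0 <= t <= 1 -> M_map (F t).
Hypothesis F_cont : forall t x e, 0 <= t <= 1 -> 0 < e -> exists2 d, 0 < d &
  forall s y, 0 <= s <= 1 -> `|s - t| < d -> nearM d x y ->
    nearM e (F t x) (F s y).

Lemma family_M_cont t : 0 <= t <= 1 -> M_cont (F t).
Proof.
move=> t01 x e e0; have [d d0 hd] := F_cont t x e t01 e0.
by exists d => // y xy; apply: hd => //; rewrite subrr normr0.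
Qed.

Lemma family_M_test phi t : 0 <= t <= 1 -> M_test phi ->
  M_test (fun x => phi (F t x)).
Proof.
by move=> t01; apply: M_test_comp; [exact: F_map|exact: family_M_cont].
Qed.

(** Joint continuity gives a [d] near each [x]; compactness of [0, 1] makes it uniform there, and
    [fpart] carries it to all real [x]. *)
Lemma family_uniform phi t (e : R) : 0 <= t <= 1 -> M_test phi -> 0 < e ->
  exists2 d, 0 < d & forall s x, 0 <= s <= 1 -> `|s - t| < d ->
    `|phi (F t x) - phi (F s x)| < e.
Proof.
move=> t01 phiT e0.
have e20 : 0 < e / 2 by lra.
have /compact_near_coveringP cov := @segment_compact R 0 1.
have := cov R (nbhs t)
  (fun s x => 0 <= s <= 1 -> `|phi (F t x) - phi (F s x)| < e) _.
case.
  move=> x _.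
  have [d1 d10 hd1] := M_test_near phi (F t x) (e / 2) phiT e20.
  have [d d0 hd] := F_cont t x d1 t01 d10.
  exists (ball x d, ball t d); first by split; exact: nbhsx_ballx.
  move=> [y s] [/= xy ts] s01.
  have near_y : nearM d x y by apply: nearM_norm; rewrite distrC.
  have h1 : `|phi (F t x) - phi (F t y)| < e / 2.
    by apply/hd1/hd => //; rewrite subrr normr0.
  have h2 : `|phi (F t x) - phi (F s y)| < e / 2.
    by apply/hd1/hd => //; rewrite distrC.
  rewrite (le_lt_trans (ler_distD (phi (F t x)) _ _))//.
  by rewrite distrC; lra.
move=> d d0 hd; exists d => // s x s01 st.
have fpartF u : 0 <= u <= 1 -> phi (F u x) = phi (F u (fpart x)).
  by move=> u01; apply/esym/(M_test_eqM phi) => //; exact/F_map/eqM_fpart.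
rewrite !fpartF//; apply: (hd s) => //; first by rewrite /ball/= distrC.
by rewrite /= in_itv/= fpart_ge0 ltW// fpart_lt1.
Qed.

Section average.
Context (P : probability R R) (phi : R -> R).
Hypothesis phiT : M_test phi.

Definition average t : R := \int[P]_x phi (F t x).

Lemma average_dist (t s e : R) : 0 <= t <= 1 -> 0 <= s <= 1 ->
  (forall x, `|phi (F t x) - phi (F s x)| <= e) ->
  `|average t - average s| <= e.
Proof.
move=> t01 s01 he.
have it := M_test_integrable P _ (family_M_test _ _ t01 phiT).
have is1 := M_test_integrable P _ (family_M_test _ _ s01 phiT).
rewrite /average -RintegralB//.
have iB : P.-integrable setT (EFin \o (fun x => phi (F t x) - phi (F s x))).
  exact: (integrableB _ it is1).
rewrite (le_trans (le_normr_Rintegral _ iB))//.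
rewrite -[leRHS](Rintegral_probability_cst P).
apply: le_Rintegral => //.
  exact: (integrable_abse iB).
by apply: (bounded_integrable _ _ _ `|e|) => // x _ /=.
Qed.

(** Supplies the measurability in [t] needed to integrate [average] against [theta]. *)
Lemma average_continuous : {within `[0, 1], continuous average}.
Proof.
apply/subspace_continuousP => t; rewrite /= in_itv/= => t01.
apply/cvgrPdist_le => e e0.
have [d d0 hd] := family_uniform phi t e t01 phiT e0.
apply/nbhs_ballP; exists d => // s; rewrite /ball/= distrC => ts.
rewrite in_itv/= => s01.
by apply: average_dist => // x; exact/ltW/hd.
Qed.

Lemma average_integrable (theta : probability R R) :
  theta.-integrable `[0, 1] (EFin \o average).
Proof.
have [C C0 hC] := M_test_bounded phi phiT.
apply: (bounded_integrable _ _ _ C) => //.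
  by apply: subspace_continuous_measurable_fun => //; exact: average_continuous.
move=> t; rewrite /= in_itv/= => t01.
have it := M_test_integrable P _ (family_M_test _ _ t01 phiT).
rewrite (le_trans (le_normr_Rintegral _ it))//.
rewrite -[leRHS](Rintegral_probability_cst P).
apply: le_Rintegral => //; first exact: (integrable_abse it).
by apply: (bounded_integrable _ _ _ C) => // x _ /=; rewrite ger0_norm.
Qed.

Lemma stationary_average (theta : probability R R) : stationary F theta P ->
  \int[P]_x phi x = \int[theta]_(t in `[0, 1]) average t.
Proof.
move=> /(_ phi phiT); rewrite /Rintegral => ->; congr fine.
apply: eq_integral => t; rewrite inE/= in_itv/= => t01.
rewrite fineK//; apply: integrable_fin_num => //.
exact/M_test_integrable/family_M_test.
Qed.

(* For t < d the averages at t and 0 are e-close; for t >= d the linear term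
   dominates the trivial bound 2 * C. *)
Lemma stationary_defect (theta : probability R R) (e C d : R) :
  stationary F theta P -> theta `[0, 1]%classic = 1%E ->
  0 <= e -> 0 < d -> (forall x, `|phi x| <= C) ->
  (forall s x, 0 <= s <= 1 -> `|s - 0| < d ->
    `|phi (F 0 x) - phi (F s x)| < e) ->
  `|\int[P]_x phi x - \int[P]_x phi (F 0 x)| <=
  \int[theta]_(t in `[0, 1]) (e + 2 * C / d * t).
Proof.
move=> st th1 e0 d0 hC hd.
have C0 : 0 <= C by exact: le_trans (normr_ge0 _) (hC 0).
(* As [theta] has mass 1 on [0, 1], the constant becomes a [theta]-integral and the difference can
   be estimated under one integral sign. *)
have -> : \int[P]_x phi (F 0 x) = \int[theta]_(t in `[0, 1]) cst (average 0) t.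
  by rewrite Rintegral_cst// [X in fine X]th1 mulr1.
have i0 : theta.-integrable `[0, 1] (EFin \o cst (average 0)).
  by apply: (bounded_integrable _ _ _ `|average 0|).
rewrite (stationary_average _ st) -RintegralB//; last exact: average_integrable.
have iB : theta.-integrable `[0, 1]
    (EFin \o (fun t => average t - cst (average 0) t)).
  exact: (integrableB _ (average_integrable theta) i0).
rewrite (le_trans (le_normr_Rintegral _ iB))//.
have Cd0 : 0 <= 2 * C / d by rewrite divr_ge0 ?mulr_ge0// ltW.
apply: le_Rintegral => //; first exact: (integrable_abse iB).
  apply: (bounded_integrable _ _ _ (e + 2 * C / d)) => //.
    by apply: measurable_funTS; apply: measurable_funD.
  move=> t; rewrite /= in_itv/= => /andP[t0 t1].
  rewrite ger0_norm; last by rewrite addr_ge0// mulr_ge0.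
  by rewrite lerD2l ler_piMr.
move=> t; rewrite /= in_itv/= => /andP[t0 t1].
rewrite distrC; apply: average_dist; rewrite ?lexx ?ler01 ?t0//.
move=> x; have [td|dt] := ltP t d.
  rewrite (le_trans (ltW (hd t x _ _))) ?t0 ?subr0 ?ger0_norm//.
  by rewrite lerDl mulr_ge0.
rewrite (le_trans (ler_normB _ _))// (le_trans (lerD (hC _) (hC _)))//.
have : 2 * C <= 2 * C / d * t.
  by rewrite mulrAC ler_pdivlMr// ler_wpM2l// mulr_ge0.
by lra.
Qed.

End average.

End family.

(** * Passage to the limit *)

Theorem theoremF (R : realType) (F : R -> R -> R)
    (theta mu : R -> probability R R) :
  (* each f_t, t in [0,1], is a circle homeomorphism *)
  (forall t, 0 <= t <= 1 -> circle_homeo (F t)) ->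
  (* the family is (jointly) continuous on [0,1] x M *)
  (forall t x e, 0 <= t <= 1 -> 0 < e -> exists2 d, 0 < d &
     forall s y, 0 <= s <= 1 -> `|s - t| < d -> nearM d x y ->
       nearM e (F t x) (F s y)) ->
  (* f_0 is a saddle-node circle homeomorphism *)
  saddle_node (F 0) ->
  (* theta_eps are probability measures on [0,1] *)
  (forall e, 0 < e -> theta e `[0, 1]%classic = 1%E) ->
  (* theta_eps --> delta_0 weak-* as eps -> 0 *)
  (forall g : R -> R, {within `[0, 1]%classic, continuous g} ->
     (fun e => (\int[theta e]_(t in `[0%R, 1%R]%classic) (g t)%:E)%E) @ 0^'+ --> (g 0)%:E) ->
  (* for every eps close to 0, mu_eps is an eps-stationary probability on M *)
  (exists2 e0, 0 < e0 & forall e, 0 < e < e0 ->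
     M_prob (mu e) /\ stationary F (theta e) (mu e)) ->
  (* every weak-* accumulation point as eps -> 0 is delta_0 *)
  forall mu0 : probability R R, M_prob mu0 ->
  (exists u : nat -> R, [/\ (forall n, 0 < u n), u @ \oo --> 0 &
     forall phi : R -> R, M_test phi ->
       (fun n => (\int[mu (u n)]_x (phi x)%:E)%E) @ \oo --> (\int[mu0]_x (phi x)%:E)%E]) ->
  forall A : set R, measurable A -> mu0 A = \d_(0 : R) A.
Proof.
move=> Fh Fc sn th1 thc [e0 e00 hmu] mu0 mu0P [u [u0 ucvg mucvg]].
have z01 : 0 <= (0 : R) <= 1 by rewrite lexx ler01.
have Fm t : 0 <= t <= 1 -> M_map (F t) by move=> /Fh[].
apply: (invariant_saddle_node_dirac (F 0)) => // phi phiT.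
have phi0T : M_test (fun x => phi (F 0 x)) by exact: (family_M_test F).
have Rcvg psi : M_test psi ->
    \int[mu (u n)]_x psi x @[n --> \oo] --> \int[mu0]_x psi x.
  move=> psiT; apply: fine_cvg; rewrite fineK; first exact: mucvg.
  by apply: integrable_fin_num => //; exact: M_test_integrable.
have [C _ hC] := M_test_bounded phi phiT.
(* Invariance of [mu0] follows once the defect is at most [e] for every positive [e]. *)
apply/esym/eqP; rewrite -subr_eq0 -normr_le0; apply/ler_addgt0Pr => e e_gt0.
rewrite add0r; have e20 : 0 < e / 2 by lra.
have [d d0 hd] := family_uniform F Fm Fc phi 0 (e / 2) z01 phiT e20.
(* A continuous majorant of the defect, to which weak-* convergence applies directly; its integrals
   tend to [q 0 = e / 2]. *)
pose q t : R := e / 2 + 2 * C / d * t.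
have qcvg : \int[theta (u n)]_(t in `[0, 1]) q t @[n --> \oo] --> e / 2.
  have qc : {within `[0, 1], continuous q}.
    apply: continuous_subspaceT => t; apply: cvgD; first exact: cvg_cst.
    by apply: cvgMl_tmp; exact: cvg_id.
  have := thc q qc; rewrite {2}/q mulr0 addr0 => /fine_cvg h.
  (* The limit at 0 from the right is read along the positive sequence [u]. *)
  by move/cvg_at_rightP : h; apply.
have : \forall n \near \oo,
    `|\int[mu (u n)]_x phi x - \int[mu (u n)]_x phi (F 0 x)| <= e.
  have /cvgrPdist_lt/(_ _ e20) hq := qcvg.
  have /cvgrPdist_lt/(_ _ e00) hu := ucvg.
  near=> n.
  have un : 0 < u n < e0.
    rewrite u0/=; have : `|0 - u n| < e0 by near: n.
    by rewrite sub0r normrN gtr0_norm.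
  have [_ stn] := hmu _ un.
  apply: le_trans (stationary_defect F Fm Fc _ _ phiT _ _ _ _
    stn (th1 _ (u0 n)) (ltW e20) d0 hC hd) _.
  have : `|e / 2 - \int[theta (u n)]_(t in `[0, 1]) q t| < e / 2 by near: n.
  by rewrite ltr_norml /q => /andP[h _]; lra.
(* Both [phi] and its composition with [F 0] are test functions, so the bound survives in the
   limit. *)
exact: cvgr_to_le (cvg_norm (cvgB (Rcvg _ phiT) (Rcvg _ phi0T))).
Unshelve. all: by end_near.
Qed.
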